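(* For every positive integer $n$ there exist integers $x_1, x_2, x_3, x_4 \in \mathbb{Z}$ such that $n = x_1^2 + x_2^2 + x_3^2 + x_4^2$. *)

(* Defs.v *)
From mathcomp Require Export all_boot all_order all_algebra.

(* Main.v *)
Require Import Defs.
From mathcomp Require Import all_boot all_order all_algebra.
From mathcomp Require Import zify ring lra.
Import Order.TTheory GRing.Theory Num.Theory.
Local Open Scope ring_scope.

(** Sums of four squares are closed under multiplication (Euler), so it is
    enough to treat a prime [p].  The squares of 'F_p fill more than half of
    the field, so by the pigeonhole principle -1 is a sum of two of them
    ([sum2sq_finField]).  Lifting to centered residues yields a multiple
    [m * p] with [0 < m < p] that is a sum of four squares
    ([prime_multiple_sum4sq]).

    Lagrange's descent then lowers [m] to 1.  If [m > 1] and
    [m * p = \sum x_i ^ 2], reduce every [x_i] to its centered residue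
    [y_i = x_i - m * k_i] modulo [m].  Then [\sum y_i ^ 2 = m * r] with
    [0 <= r <= m], and [r * p] is again a sum of four squares
    ([sum4sq_descent]).  The extreme cases [r = 0] and [r = m] force every
    [2 * y_i] to be a multiple of [m], hence [m ^ 2] to divide [m * p], which is
    impossible for [1 < m < p] ([sum4sq_prime_of_multiple]). *)

Definition sum4sq (n : int) : Prop :=
  exists x1 x2 x3 x4 : int, n = x1 ^+ 2 + x2 ^+ 2 + x3 ^+ 2 + x4 ^+ 2.

(** Euler's identity: the norm of quaternions is multiplicative. *)
Lemma sum4sqM (m n : int) : sum4sq m -> sum4sq n -> sum4sq (m * n).
Proof.
move=> [a [b [c [d ->]]]] [x [y [z [t ->]]]].
exists (a * x + b * y + c * z + d * t), (a * y - b * x + c * t - d * z),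
  (a * z - b * t - c * x + d * y), (a * t + b * z - c * y - d * x).
ring.
Qed.

(** Squaring is at most two-to-one, and one-to-one over 0; the latter makes
    the bound strict, in characteristic 2 as well. *)
Lemma card_squares_gt (F : finFieldType) :
  (#|F| < 2 * #|[set x ^+ 2 | x : F]|)%N.
Proof.
set A := [set _ | _ : F].
have A0 : 0 \in A by apply/imsetP; exists 0; rewrite ?expr0n.
rewrite -[#|F|]sum1_card (partition_big (fun x : F => x ^+ 2) (mem A)) /=;
  last by move=> x _; apply/imsetP; exists x.
rewrite (bigD1 0) //= (cardsD1 0 A) A0.
have -> : (\sum_(i : F | i ^+ 2 == 0%R) 1 = 1)%N.
  rewrite (eq_bigl (pred1 0)) ?big_pred1_eq // => i /=.
  by rewrite sqrf_eq0.
rewrite mulnDr muln1 !addSn !add0n !ltnS mulnC -sum_nat_const.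
rewrite (eq_bigl (mem (A :\ 0))) => [|y]; last by rewrite !inE andbC.
apply: leq_sum => y /setD1P[_ /imsetP[x _ ->]].
rewrite sum1_card; apply: leq_trans (subset_leq_card _) (card_size [:: x; - x]).
by apply/subsetP=> z; rewrite !inE -[z \in _]/(z ^+ 2 == x ^+ 2) eqf_sqr.
Qed.

(** The set of squares and its image under [y |-> a - y] are too large to be
    disjoint. *)
Lemma sum2sq_finField (F : finFieldType) (a : F) :
  exists x y : F, a = x ^+ 2 + y ^+ 2.
Proof.
set A := [set x ^+ 2 | x : F]; set B := [set a - y | y in A].
have cardB : #|B| = #|A| by apply: card_imset => y z /addrI /oppr_inj.
have [/setP disjAB|[z /setIP[]]] := set_0Vmem (A :&: B).
  have := card_squares_gt F; rewrite -/A mul2n -addnn -{2}cardB.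
  rewrite -cardsUI (_ : A :&: B = set0) ?cards0 ?addn0; last exact/setP.
  by rewrite ltnNge max_card.
move=> /imsetP[x _ ->] /imsetP[_ /imsetP[y _ ->] E].
by exists x, y; rewrite E subrK.
Qed.

Lemma centered_residue (m x : int) : 0 < m ->
  exists k : int, `|2 * (x - m * k)| <= m.
Proof. by move=> m0; exists ((2 * x + m) %/ (2 * m))%Z; lia. Qed.

Lemma sqr_centered_le (m y : int) : `|2 * y| <= m -> 4 * y ^+ 2 <= m ^+ 2.
Proof.
move=> h; have -> : 4 * y ^+ 2 = `|2 * y| ^+ 2.
  by rewrite real_normK ?num_real //; ring.
by rewrite lerXn2r ?nnegrE // (le_trans _ h).
Qed.

(** From [-1 = x ^ 2 + y ^ 2] in 'F_p, with centered representatives [a] and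
    [b], the multiple is [1 + a ^ 2 + b ^ 2], at most [1 + p ^ 2 / 2 < p ^ 2]. *)
Lemma prime_multiple_sum4sq (p : nat) : prime p ->
  exists2 m : int, 0 < m < p%:Z & sum4sq (m * p%:Z).
Proof.
move=> p_pr; have p1 := prime_gt1 p_pr.
have [x [y xy]] := sum2sq_finField _ (-1 : 'F_p).
have [k hk] := centered_residue p%:Z (x : nat)%:Z ltac:(lia).
have [l hl] := centered_residue p%:Z (y : nat)%:Z ltac:(lia).
have /dvdnP[q hq] : (p %| 1 + x ^ 2 + y ^ 2)%N.
  rewrite (dvdn_pcharf (pchar_Fp p_pr)) !natrD !natrX !natr_Zp.
  by rewrite -addrA -xy subrr.
have {}hq : q%:Z * p%:Z = 1 + (x : nat)%:Z ^+ 2 + (y : nat)%:Z ^+ 2.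
  by rewrite -PoszM -hq !PoszD -!mulnn !PoszM -!expr2.
(* [m] is the quotient of [1 + a ^ 2 + b ^ 2] by [p], given that [q] is the
   quotient of [1 + x ^ 2 + y ^ 2]. *)
set a := _ - _ in hk; set b := _ - _ in hl.
pose m := q%:Z - 2 * k * (x : nat)%:Z + p%:Z * k ^+ 2
          - 2 * l * (y : nat)%:Z + p%:Z * l ^+ 2.
have hm : m * p%:Z = 1 ^+ 2 + a ^+ 2 + b ^+ 2 + 0 ^+ 2.
  by rewrite /m /a /b; lra.
have ha := sqr_centered_le _ _ hk; have hb := sqr_centered_le _ _ hl.
exists m; last by exists 1, a, b, 0.
by clearbody m a b; apply/andP; split; nia.
Qed.

(** The identity behind the descent.  Euler's identity writes
    [(m * p) * (m * r)] as four squares of multiples of [m]; the witnesses are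
    the quotients by [m], so that no division takes place. *)
Lemma sum4sq_descent (m p x1 x2 x3 x4 k1 k2 k3 k4 : int) :
  m * p = x1 ^+ 2 + x2 ^+ 2 + x3 ^+ 2 + x4 ^+ 2 ->
  exists2 r : int, sum4sq (r * p)
    & m * r = (x1 - m * k1) ^+ 2 + (x2 - m * k2) ^+ 2
            + (x3 - m * k3) ^+ 2 + (x4 - m * k4) ^+ 2.
Proof.
move=> E.
exists (p - 2 * (x1 * k1 + x2 * k2 + x3 * k3 + x4 * k4)
        + m * (k1 ^+ 2 + k2 ^+ 2 + k3 ^+ 2 + k4 ^+ 2)); last by lra.
exists (p - (x1 * k1 + x2 * k2 + x3 * k3 + x4 * k4)),
  (x1 * k2 - x2 * k1 + x3 * k4 - x4 * k3),
  (x1 * k3 - x2 * k4 - x3 * k1 + x4 * k2),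
  (x1 * k4 + x2 * k3 - x3 * k2 - x4 * k1).
have := congr1 ( *%R (k1 ^+ 2 + k2 ^+ 2 + k3 ^+ 2 + k4 ^+ 2)) E.
by lra.
Qed.

(** With [y = x - m * k], the difference is [(m * k) * (2 * y) + (m * k) ^ 2].
    The hypothesis covers exactly the extreme centered residues, [y = 0] and
    [2 * y = m] up to sign. *)
Lemma dvdz_sqr_residue (m x k : int) : (m %| 2 * (x - m * k))%Z ->
  (m ^+ 2 %| x ^+ 2 - (x - m * k) ^+ 2)%Z.
Proof.
move=> /dvdzP[q hq]; apply/dvdzP; exists (k * q + k ^+ 2).
by have := congr1 ( *%R (m * k)) hq; lra.
Qed.

Lemma sum4sq_prime_of_multiple (p : nat) (m : int) : prime p ->
  0 < m < p%:Z -> sum4sq (m * p%:Z) -> sum4sq p%:Z.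
Proof.
move=> p_pr; move: m; case=> // m; elim/ltn_ind: m => m IH /andP[m0 mp] S.
have [m1|m1] := eqVneq m 1%N; first by rewrite m1 mul1r in S.
have [x1 [x2 [x3 [x4 E]]]] := S.
have [k1 h1] := centered_residue _ x1 m0.
have [k2 h2] := centered_residue _ x2 m0.
have [k3 h3] := centered_residue _ x3 m0.
have [k4 h4] := centered_residue _ x4 m0.
have [r Sr Er] := sum4sq_descent _ _ _ _ _ _ k1 k2 k3 k4 E.
have d1 := dvdz_sqr_residue m x1 k1; have d2 := dvdz_sqr_residue m x2 k2.
have d3 := dvdz_sqr_residue m x3 k3; have d4 := dvdz_sqr_residue m x4 k4.
move: (x1 - _) (x2 - _) (x3 - _) (x4 - _) h1 h2 h3 h4 Er d1 d2 d3 d4.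
move=> y1 y2 y3 y4 h1 h2 h3 h4 Er d1 d2 d3 d4.
have q1 := sqr_centered_le _ _ h1; have q2 := sqr_centered_le _ _ h2.
have q3 := sqr_centered_le _ _ h3; have q4 := sqr_centered_le _ _ h4.
have r0 : 0 <= r by rewrite -(pmulr_rge0 _ m0) Er !addr_ge0 ?sqr_ge0.
have rm : r <= m by rewrite -(ler_pM2l m0) Er; lra.
(* [m ^ 2] would divide every [x_i ^ 2 - y_i ^ 2] and [m * r], the sum of the
   [y_i ^ 2]; hence it would divide [m * p]. *)
have mid : ~ ((m%:Z %| 2 * y1)%Z /\ (m%:Z %| 2 * y2)%Z /\
              (m%:Z %| 2 * y3)%Z /\ (m%:Z %| 2 * y4)%Z /\ (m%:Z %| r)%Z).
  move=> [/d1 {}d1 [/d2 {}d2 [/d3 {}d3 [/d4 {}d4 dr]]]].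
  have : (m%:Z ^+ 2 %| m%:Z * p%:Z)%Z.
    have -> : m%:Z * p%:Z = (x1 ^+ 2 - y1 ^+ 2) + (x2 ^+ 2 - y2 ^+ 2)
       + (x3 ^+ 2 - y3 ^+ 2) + (x4 ^+ 2 - y4 ^+ 2) + m%:Z * r.
      by rewrite E Er; ring.
    apply: rpredD (rpredD (rpredD (rpredD d1 d2) d3) d4) _.
    by rewrite expr2; apply: dvdz_mul.
  rewrite expr2 dvdz_mul2l ?gt_eqF //.
  rewrite dvdzE /= => /(prime_nt_dvdP p_pr m1) mE.
  by rewrite mE ltxx in mp.
have dvd_of_sqr (y : int) : y ^+ 2 = 0 \/ 4 * y ^+ 2 = m%:Z ^+ 2 ->
    (m%:Z %| 2 * y)%Z.
  case=> [/eqP|e]; first by rewrite sqrf_eq0 => /eqP->; rewrite mulr0 dvdz0.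
  have /eqP : (2 * y) ^+ 2 = m%:Z ^+ 2 by rewrite -e; ring.
  by rewrite eqf_sqr => /orP[] /eqP ->; rewrite dvdzE ?abszN.
have p1 := sqr_ge0 y1; have p2 := sqr_ge0 y2.
have p3 := sqr_ge0 y3; have p4 := sqr_ge0 y4.
have [rE|r_neq0] := eqVneq r 0.
  rewrite rE mulr0 in Er.
  by case: mid; rewrite rE dvdz0; do !split; apply: dvd_of_sqr; left; lra.
(* Each [4 * y_i ^ 2] is at most [m ^ 2] and their sum is [4 * m ^ 2]. *)
have [rE|r_neqm] := eqVneq r m.
  rewrite rE -expr2 in Er.
  by case: mid; rewrite rE dvdzz; do !split; apply: dvd_of_sqr; right; lra.
have r_lt_m : r < m by rewrite lt_neqAle r_neqm.
have r_bd : 0 < r < p by rewrite lt_def r_neq0 r0 (lt_trans r_lt_m).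
by case: r r_lt_m r_bd Sr {r0 rm r_neq0 r_neqm Er mid} => // r; apply: IH.
Qed.

Lemma sum4sq_nat (n : nat) : (0 < n)%N -> sum4sq n%:Z.
Proof.
elim/ltn_ind: n => n IH n0.
have [n1|n1] := leqP n 1.
  by exists 1, 0, 0, 0; rewrite !expr0n /= expr1n !addr0; congr Posz; lia.
have p_pr := pdiv_prime n1.
rewrite -(divnK (pdiv_dvd n)) PoszM; apply: sum4sqM.
  by apply: IH; rewrite ?ltn_Pdiv ?prime_gt1 // divn_gt0 ?pdiv_leq ?pdiv_gt0.
have [m m_bd] := prime_multiple_sum4sq _ p_pr.
exact: sum4sq_prime_of_multiple.
Qed.

(* MathComp world *)
Theorem theorem2 (n : int) (hn : 0 < n) :
  exists x1 x2 x3 x4 : int, n = x1 ^+ 2 + x2 ^+ 2 + x3 ^+ 2 + x4 ^+ 2.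
Proof. by case: n hn => // n; apply: sum4sq_nat. Qed.
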